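(* There exists a $4$-dimensional real solvable Lie algebra $\mathfrak{g}$ defined over the field $\mathbb{Q}(\sqrt2,\sqrt3)$ (i.e. having a basis whose structure constants lie in $\mathbb{Q}(\sqrt2,\sqrt3)$), with $\dim\mathfrak{g}'=2$ and $\mathfrak{g}''=\{0\}$, such that every Lie group $G$ with Lie algebra $\mathfrak{g}$ admits a left-invariant Riemannian metric that is non-trivially Bach-flat, that is, a metric whose Bach tensor is zero, whose conformal class contains no Einstein metric, and which is not half conformally flat (neither $W_+=0$ nor $W_-=0$).
   Context: Here $\mathfrak{g}'=[\mathfrak{g},\mathfrak{g}]$ and $\mathfrak{g}''=[\mathfrak{g}',\mathfrak{g}']$ are the first two terms of the derived series. For an oriented Riemannian $4$-manifold $(M,g)$, the Weyl tensor decomposes as $W=W_++W_-$ into its self-dual and anti-self-dual parts; $g$ is half conformally flat if $W_+=0$ or $W_-=0$. (A Lie group is given a left-invariant orientation.) The conformal class $[g]$ is the set of metrics $e^{2f}g$ with $f$ a smooth function on $M$; $g$ is conformally Einstein if $[g]$ contains an Einstein metric. The Bach tensor $B$ is the conformally invariant, trace-free symmetric $2$-tensor which (up to a constant factor) is, for compact $M$, the gradient of $g\mapsto\int_M\|W[g]\|^2\,d\upsilon_g$. For a left-invariant metric on a $4$-dimensional Lie group (whose scalar curvature is constant), it is given in an orthonormal frame $(e_i)$ by $$B_{ij}=\sum_{p}\nabla_p\nabla_j\rho_{ip}-\tfrac12\sum_{p}\nabla_p\nabla_p\rho_{ij}+\tfrac13\tau\rho_{ij}-\sum_p\rho_{pi}\rho_{pj}+\tfrac1{12}\Big[3\sum_{r,s}(\rho_{rs})^2-\tau^2\Big]\delta_{ij},$$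 where $\nabla$ is the Levi-Civita connection (and $\nabla_p\nabla_q$ denotes components of the second covariant derivative), $\rho$ the Ricci tensor and $\tau$ the scalar curvature. A metric is Bach-flat if $B=0$. It is non-trivially Bach-flat if it is Bach-flat but neither conformally Einstein nor half conformally flat. *)

(* Defs.v *)
From HB Require Import structures.
From mathcomp Require Import all_boot all_order all_algebra.
From mathcomp Require Import all_classical all_reals all_analysis.
Set Implicit Arguments.
Unset Strict Implicit.
Unset Printing Implicit Defensive.
Import Order.TTheory GRing.Theory Num.Theory.
Import numFieldNormedType.Exports.
Local Open Scope classical_set_scope.
Local Open Scope ring_scope.

(** * Lie algebras *)

Record lieAlgebra (K : fieldType) := LieAlgebra {
  lie_sort :> vectType K;
  brk : lie_sort -> lie_sort -> lie_sort;
  brk_linearl : forall y, linear (fun x => brk x y);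
  brk_linearr : forall x, linear (brk x);
  brk_alt : forall x, brk x x = 0;
  brk_jacobi : forall x y z,
    brk x (brk y z) + brk y (brk z x) + brk z (brk x y) = 0 }.

Section LieAlgebra.
Variables (K : fieldType) (g : lieAlgebra K).

(* By bilinearity, the brackets of two bases span the same subspace as all the
   brackets [u, v] with u in U and v in V. *)
Definition brkv (U V : {vspace g}) : {vspace g} :=
  <<[seq brk u v | u <- vbasis U, v <- vbasis V]>>%VS.

Definition derived (k : nat) : {vspace g} := iter k (fun U => brkv U U) fullv.

Definition lie_solvable : Prop := exists k, derived k = 0%VS.

Definition str_const n (e : n.-tuple g) (i j k : 'I_n) : K :=
  coord e k (brk (tnth e i) (tnth e j)).

Definition defined_over (F : K -> Prop) : Prop :=
  exists2 e : (\dim {:g}).-tuple g,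
    basis_of fullv e & forall i j k, F (str_const e i j k).

End LieAlgebra.

(* Membership in the subfield generated by s. *)
Definition gen_subfield (K : fieldType) (s : seq K) (x : K) : Prop :=
  forall F : {pred K}, divring_closed F -> {subset s <= F} -> x \in F.

(** * Smooth manifolds and Lie groups *)

Section Smooth.
Variables (R : realType) (n : nat).
Implicit Types (U : set 'rV[R]_n) (f : 'rV[R]_n -> R).

Fixpoint iter_partial (s : seq 'I_n) f : 'rV[R]_n -> R :=
  if s is i :: s' then iter_partial s' (fun x => 'D_(delta_mx 0 i) f x) else f.

(* On an open set U this is C^oo: every iterated partial derivative is
   Frechet-differentiable, hence continuous, on U. *)
Definition smooth_on U f : Prop :=
  forall s x, U x -> differentiable (iter_partial s f) x.

Variable T : topologicalType.

Record chart := Chart {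
  cdom : set T;
  cmap : T -> 'rV[R]_n;
  cinv : 'rV[R]_n -> T;
  cdom_open : open cdom;
  cran_open : open (cmap @` cdom);
  cmapK : forall p, cdom p -> cinv (cmap p) = p;
  cmap_cont : {within cdom, continuous cmap};
  cinv_cont : {within cmap @` cdom, continuous cinv} }.

Definition cran (c : chart) : set 'rV[R]_n := cmap c @` cdom c.

Record atlas := Atlas {
  charts : set chart;
  charts_cover : forall p, exists2 c, charts c & cdom c p;
  charts_compat : forall c d, charts c -> charts d -> forall k,
    smooth_on (cmap c @` (cdom c `&` cdom d))
              (fun x => cmap d (cinv c x) 0 k) }.

End Smooth.

#[short(type="topGroupType")]
HB.structure Definition TopGroup := {G of Group G & Topological G}.

Record lieGroup (R : realType) (n : nat) := LieGroup {
  lg_sort :> topGroupType;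
  lg_hausdorff : hausdorff_space lg_sort;
  lg_second_countable : @second_countable lg_sort;
  lg_atlas : atlas R n lg_sort;
  lg_mul_cont : continuous (fun z : lg_sort * lg_sort => (z.1 * z.2)%g);
  lg_inv_cont : continuous (fun x : lg_sort => (x^-1)%g);
  lg_mul_smooth : forall a b c,
    charts lg_atlas a -> charts lg_atlas b -> charts lg_atlas c -> forall k,
    smooth_on
      [set z : 'rV[R]_(n + n) | [/\ cran a (lsubmx z), cran b (rsubmx z) &
         cdom c (cinv a (lsubmx z) * cinv b (rsubmx z))%g]]
      (fun z => cmap c (cinv a (lsubmx z) * cinv b (rsubmx z))%g 0 k);
  lg_inv_smooth : forall a c, charts lg_atlas a -> charts lg_atlas c -> forall k,
    smooth_on [set x | cran a x /\ cdom c ((cinv a x)^-1)%g]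
              (fun x => cmap c ((cinv a x)^-1)%g 0 k) }.

Section LieGroup.
Variables (R : realType) (n : nat) (G : lieGroup R n).
Implicit Types (f : G -> R) (X Y : (G -> R) -> (G -> R)).

Definition smooth f : Prop :=
  forall c, charts (lg_atlas G) c -> smooth_on (cran c) (f \o cinv c).

(* Vector fields are the derivations of the algebra of smooth functions. They
   are represented by operators on all functions, of which only the action on
   smooth functions is relevant: eqvf is the corresponding equality. *)
Definition vector_field X : Prop :=
  [/\ forall f, smooth f -> smooth (X f),
      forall (a : R) f1 f2, smooth f1 -> smooth f2 -> forall p,
        X (fun q => a * f1 q + f2 q) p = a * X f1 p + X f2 p
    & forall f1 f2, smooth f1 -> smooth f2 -> forall p,
        X (fun q => f1 q * f2 q) p = f1 p * X f2 p + f2 p * X f1 p].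

Definition eqvf X Y : Prop := forall f, smooth f -> forall p, X f p = Y f p.

Definition left_invariant X : Prop := forall a f, smooth f -> forall p,
  X (fun q => f (a * q)%g) p = X f (a * p)%g.

(* phi is an isomorphism from g onto the Lie algebra of left-invariant vector
   fields on G, with bracket the commutator of derivations. *)
Definition lie_algebra_of (g : lieAlgebra R)
    (phi : g -> (G -> R) -> (G -> R)) : Prop :=
  [/\ forall x, vector_field (phi x) /\ left_invariant (phi x),
      forall a x y,
        eqvf (phi (a *: x + y)) (fun f p => a * phi x f p + phi y f p),
      forall x y, eqvf (phi (brk x y))
        (fun f p => phi x (phi y f) p - phi y (phi x f) p),
      forall x, eqvf (phi x) (fun _ _ => 0) -> x = 0
    & forall X, vector_field X -> left_invariant X ->
        exists x, eqvf X (phi x)].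

End LieGroup.

(** * Riemannian metrics on a Lie group *)

(* An isomorphism phi as above trivialises the tangent bundle of G: x in g
   stands for the tangent vector at p of the left-invariant field phi x. A
   metric m on G is thus a family of inner products m p on g, m p x y being the
   value at p of m (phi x) (phi y), and left translations act trivially on g. *)
Section Metric.
Variables (R : realType) (n : nat) (G : lieGroup R n) (g : lieAlgebra R).
Implicit Types m : G -> g -> g -> R.

Definition riemannian_metric m : Prop :=
  [/\ forall p (a : R) x y z, m p (a *: x + y) z = a * m p x z + m p y z,
      forall p x y, m p x y = m p y x,
      forall p x, x != 0 -> 0 < m p x x
    & forall x y, smooth (fun p => m p x y)].

Definition left_invariant_metric m : Prop :=
  forall a p x y, m (a * p)%g x y = m p x y.

Definition conformal_change (f : G -> R) m : G -> g -> g -> R :=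
  fun p x y => expR (2 * f p) * m p x y.

End Metric.

(* Curvature in components, with respect to the global left-invariant frame
   E_i = phi (e_i), where e is a basis of g. *)
Section Curvature.
Variables (R : realType) (n : nat) (G : lieGroup R n) (g : lieAlgebra R).
Variables (phi : g -> (G -> R) -> (G -> R)) (e : n.-tuple g).
Variable m : G -> g -> g -> R.
Implicit Types (i j k l p q r s : 'I_n) (x : G).

Let E i : (G -> R) -> (G -> R) := phi (tnth e i).
Let c := str_const e.

Definition gram x : 'M[R]_n := \matrix_(i, j) m x (tnth e i) (tnth e j).

(* Levi-Civita connection: nabla_(E_i) E_j = \sum_k christoffel i j k E_k, the
   inner sum over l being Koszul's formula for 2 m(nabla_(E_i) E_j, E_l). *)
Definition christoffel i j k x : R :=
  2^-1 * \sum_l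
    (E i (fun y => gram y j l) x + E j (fun y => gram y i l) x
     - E l (fun y => gram y i j) x
     + \sum_s (c i j s * gram x s l - c i l s * gram x s j
               - c j l s * gram x s i)) * invmx (gram x) l k.

(* R(E_i, E_j) E_k = \sum_l riemann i j k l E_l, where
   R(X, Y) = nabla_X nabla_Y - nabla_Y nabla_X - nabla_[X, Y] *)
Definition riemann i j k l x : R :=
  E i (christoffel j k l) x - E j (christoffel i k l) x
  + \sum_s (christoffel j k s x * christoffel i s l x
            - christoffel i k s x * christoffel j s l x
            - c i j s * christoffel s k l x).

Definition ricci j k x : R := \sum_i riemann i j k i x.

Definition einstein : Prop :=
  exists lambda : R, forall x j k, ricci j k x = lambda * gram x j k.

Definition orthonormal : Prop :=
  forall x i j, m x (tnth e i) (tnth e j) = (i == j)%:R.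

(* cov_ricci p i j = (nabla_p rho)_ij
   cov2_ricci q p i j = nabla_q nabla_p rho_ij, q being the direction of the
   outer derivative *)
Definition cov_ricci p i j x : R :=
  E p (ricci i j) x
  - \sum_s (christoffel p i s x * ricci s j x
            + christoffel p j s x * ricci i s x).

Definition cov2_ricci q p i j x : R :=
  E q (cov_ricci p i j) x
  - \sum_s (christoffel q p s x * cov_ricci s i j x
            + christoffel q i s x * cov_ricci p s j x
            + christoffel q j s x * cov_ricci p i s x).

(* From here on the formulas hold when e is orthonormal. *)
Definition scalar_curv x : R := \sum_i ricci i i x.

(* Valid for metrics of constant scalar curvature in dimension 4. *)
Definition bach i j x : R :=
  \sum_p cov2_ricci p j i p x - 2^-1 * \sum_p cov2_ricci p p i j x
  + 3^-1 * scalar_curv x * ricci i j x - \sum_p ricci p i x * ricci p j x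
  + 12^-1 * (3 * (\sum_r \sum_s ricci r s x ^+ 2) - scalar_curv x ^+ 2)
    * (i == j)%:R.

(* Weyl tensor in dimension 4, with all indices down: riemann i j k l is here
   m(R(E_i, E_j) E_k, E_l). *)
Definition weyl i j k l x : R :=
  let d a b : R := (a == b)%:R in
  riemann i j k l x
  - 2^-1 * (ricci j k x * d i l + ricci i l x * d j k
            - ricci i k x * d j l - ricci j l x * d i k)
  + 6^-1 * scalar_curv x * (d j k * d i l - d i k * d j l).

End Curvature.

Definition levi_civita (R : realType) (i j k l : 'I_4) : R :=
  let sg (a b : 'I_4) : R := Num.sg (b%:R - a%:R) in
  sg i j * sg i k * sg i l * sg j k * sg j l * sg k l.

Section BachFlat.
Variables (R : realType) (G : lieGroup R 4) (g : lieAlgebra R).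
Variables (phi : g -> (G -> R) -> (G -> R)) (m : G -> g -> g -> R).

(* The self-dual (sgn = 1) and anti-self-dual (sgn = -1) parts (W +- *W) / 2 of
   W, for the orientation in which the orthonormal frame e is positive. *)
Definition weyl_pm (sgn : R) (e : 4.-tuple g) (i j k l : 'I_4) (x : G) : R :=
  2^-1 * (weyl phi e m i j k l x
    + sgn * (2^-1 * \sum_a \sum_b levi_civita R i j a b
                                  * weyl phi e m a b k l x)).

Definition half_conformally_flat (e : 4.-tuple g) : Prop :=
  (forall i j k l x, weyl_pm 1 e i j k l x = 0) \/
  (forall i j k l x, weyl_pm (-1) e i j k l x = 0).

Definition bach_flat (e : 4.-tuple g) : Prop :=
  forall i j x, bach phi e m i j x = 0.

Definition conformally_einstein (e : 4.-tuple g) : Prop :=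
  exists2 f : G -> R, smooth f & einstein phi e (conformal_change f m).

(* The three conditions do not depend on the choice of the left-invariant
   orthonormal frame e. *)
Definition nontrivially_bach_flat : Prop :=
  exists e : 4.-tuple g,
    [/\ basis_of fullv e, orthonormal e m, bach_flat e,
        ~ conformally_einstein e & ~ half_conformally_flat e].

End BachFlat.

(* Main.v *)
From HB Require Import structures.
Require Import Defs.
From mathcomp Require Import all_boot all_order all_algebra.
From mathcomp Require Import all_classical all_reals all_analysis.
From mathcomp Require Import ring lra.
Import Order.TTheory GRing.Theory Num.Theory.
Import numFieldNormedType.Exports.
Set Implicit Arguments.
Unset Strict Implicit.
Unset Printing Implicit Defensive.
Local Open Scope classical_set_scope.
Local Open Scope ring_scope.

(** The Lie algebra is the semidirect product of two copies of R^2 in which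
   e0 acts on span (e2, e3) as L times the identity and e1 acts by
     [e1, e2] = (p - 1) e3,   [e1, e3] = (p + 1) e2.
   When L <> 0 its derived algebra is span (e2, e3), which is abelian. Take the
   left-invariant metric for which e0, ..., e3 is orthonormal. The Ricci and
   Bach tensors are diagonal in this frame (ricciE, bachE); with
   A = 3 + p^2 - L^2 and C = 3 + 5 p^2 - 3 L^2 the diagonal of the Bach tensor is
     2/3 p^2 A,   - 2 p^2 A,   2/3 p^2 A + 4/3 p C,   2/3 p^2 A - 4/3 p C.
   For p <> 0 it vanishes exactly when A = C = 0, that is when p^2 = 3 and
   L^2 = 6: this is where sqrt 2 and sqrt 3 come from.

   The metric is not half conformally flat: W_0101 <> 0, while the component
   W_2301 that the Hodge star exchanges with it is zero, so neither sign can
   make the sum of the two vanish (weyl_pm_frame).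

   It is not conformally Einstein as soon as p <> 0. If exp(2f) m is Einstein,
   with u = exp(2f) and w_i = E_i u / (2u) the frame components of df, the
   vanishing of its trace-free Ricci tensor gives (hess)
     E_2 w_1 = w_2 w_1 - p w_3,   E_3 w_1 = w_3 w_1 - p w_2,   E_3 w_2 = E_2 w_3,
     E_3 w_3 - E_2 w_2 = w_3^2 - w_2^2 - 2p,
   the last term being half the difference of two eigenvalues of the Ricci
   tensor of m. As E_2 and E_3 commute, E_2 E_3 w_1 = E_3 E_2 w_1; the terms in
   w cancel and 2 p^2 = 0 remains. Up to constant factors, this is the necessary
   condition (div W)_321 = W_321l w_l for conformally Einstein metrics: every
   W_321l is zero here, while the divergence is not.

   A vector field is an abstract derivation of the smooth functions, for which
   the chain rule E_i (exp(2f)) = 2 exp(2f) E_i f would require an argument of its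
   own. Working with u instead of f avoids it: Koszul's formula for the metric
   u m involves only E_i u and the inverse of u, and that inverse is exp(-2f),
   hence smooth. The analytic input is thus that smooth functions are closed
   under sums, products and exp. *)

(** * Operations on smooth functions *)

Lemma near_eq_differentiable (R : numFieldType) (V W : normedModType R)
    (f g : V -> W) (x : V) :
  (\forall y \near x, f y = g y) -> differentiable f x -> differentiable g x.
Proof.
move=> fg df.
have fgx : f x = g x by exact: nbhs_singleton fg.
have expand : g \o shift x = cst (g x) + 'd f x +o_ 0 id.
  apply/eqaddoP => e e0.
  have /eqaddoP /(_ e e0) := diff_locally df.
  have : \forall y \near 0, f (y + x) = g (y + x).
    by move: fg; rewrite (near_shift 0 x) subr0.
  apply: filter_app2; near=> y => fgy.
  by rewrite /= !fctE /= -fgy -fgx.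
have cont : continuous ('d f x) by exact: diff_continuous.
by apply/diff_locallyP; rewrite (diff_unique cont expand).
Unshelve. all: by end_near.
Qed.

Section SmoothOn.
Variables (R : realType) (n : nat) (U : set 'rV[R]_n).
Hypothesis openU : open U.
Implicit Types (f g : 'rV[R]_n -> R) (s : seq 'I_n) (k : nat).

Lemma near_open (P : 'rV[R]_n -> Prop) (x : 'rV[R]_n) :
  (forall y, U y -> P y) -> U x -> \forall y \near x, P y.
Proof.
move=> PU Ux; apply: filterS PU _.
by apply: open_nbhs_nbhs; split.
Qed.

(** Partial derivatives are total operators whose values matter on U only; a
   formula for D_i f on the open set U can thus be differentiated again. *)
Lemma eq_iter_partial f g s : (forall x, U x -> f x = g x) ->
  forall x, U x -> iter_partial s f x = iter_partial s g x.
Proof.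
elim: s f g => [//|i s IH] f g fg /=; apply: IH => x Ux.
by apply: near_eq_derive; apply: near_open Ux => y /fg.
Qed.

(** D_i (exp f) is the product of D_i f and exp f. To conclude by induction on the
   order of differentiation, a product has to be k times differentiable as soon
   as both of its factors are: hence the grading by k. *)
Definition Ck_on k f : Prop := forall s x, (size s <= k)%N -> U x ->
  differentiable (iter_partial s f) x.

Lemma eq_Ck_on k f g : (forall x, U x -> f x = g x) -> Ck_on k f -> Ck_on k g.
Proof.
move=> fg Cf s x sk Ux.
apply: near_eq_differentiable (Cf s x sk Ux).
by apply: near_open Ux => y Uy; exact: eq_iter_partial.
Qed.

Lemma smooth_on_Ck f : smooth_on U f <-> forall k, Ck_on k f.
Proof.
split=> [Cf k s x _ Ux|Cf s x Ux]; first exact: Cf.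
exact: (Cf (size s)).
Qed.

Lemma Ck_onS k f : Ck_on k.+1 f <-> Ck_on 0 f /\
  forall i, Ck_on k (fun x => 'D_(delta_mx 0 i) f x).
Proof.
split=> [Cf|[C0 CD] [|i s] x sk Ux]; last exact: (CD i).
  by split=> [[|//] x _ Ux|i s x sk Ux]; [exact: (Cf [::])|exact: (Cf (i :: s))].
exact: (C0 [::]).
Qed.

Lemma Ck_on_diff k f x : Ck_on k f -> U x -> differentiable f x.
Proof. by move=> Cf; exact: (Cf [::]). Qed.

Lemma Ck_on0 f : (forall x, U x -> differentiable f x) -> Ck_on 0 f.
Proof. by move=> df [|//] x _; exact: df. Qed.

Lemma Ck_onW k f : Ck_on k.+1 f -> Ck_on k f.
Proof. by move=> Cf s x sk; apply: Cf; exact: leqW. Qed.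

Lemma Ck_on_cst k (a : R) : Ck_on k (fun _ => a).
Proof.
elim: k a => [|k IH] a; first by apply: Ck_on0 => x _; exact: differentiable_cst.
apply/Ck_onS; split=> [|i].
  by apply: Ck_on0 => x _; exact: differentiable_cst.
by apply: eq_Ck_on (IH 0) => x _; rewrite derive_cst.
Qed.

Lemma Ck_onD k f g : Ck_on k f -> Ck_on k g -> Ck_on k (fun x => f x + g x).
Proof.
elim: k f g => [|k IH] f g Cf Cg.
  apply: Ck_on0 => x Ux; apply: differentiableD; [exact: Ck_on_diff Cf Ux|exact: Ck_on_diff Cg Ux].
have [[C0f Df] [C0g Dg]] := (proj1 (Ck_onS k f) Cf, proj1 (Ck_onS k g) Cg).
apply/Ck_onS; split=> [|i].
  apply: Ck_on0 => x Ux; apply: differentiableD; [exact: Ck_on_diff C0f Ux|exact: Ck_on_diff C0g Ux].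
apply: eq_Ck_on (IH _ _ (Df i) (Dg i)) => x Ux.
by rewrite deriveD//; apply: diff_derivable; [exact: Ck_on_diff C0f Ux|exact: Ck_on_diff C0g Ux].
Qed.

Lemma Ck_onM k f g : Ck_on k f -> Ck_on k g -> Ck_on k (fun x => f x * g x).
Proof.
elim: k f g => [|k IH] f g Cf Cg.
  apply: Ck_on0 => x Ux; apply: differentiableM; [exact: Ck_on_diff Cf Ux|exact: Ck_on_diff Cg Ux].
have [[C0f Df] [C0g Dg]] := (proj1 (Ck_onS k f) Cf, proj1 (Ck_onS k g) Cg).
apply/Ck_onS; split=> [|i].
  apply: Ck_on0 => x Ux; apply: differentiableM; [exact: Ck_on_diff C0f Ux|exact: Ck_on_diff C0g Ux].
apply: eq_Ck_on (Ck_onD (IH _ _ (Ck_onW Cf) (Dg i))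
                              (IH _ _ (Ck_onW Cg) (Df i))) => x Ux.
by rewrite deriveM//; apply: diff_derivable; [exact: Ck_on_diff C0f Ux|exact: Ck_on_diff C0g Ux].
Qed.

Lemma Ck_on_expR k f : Ck_on k f -> Ck_on k (fun x => expR (f x)).
Proof.
have dexp x : differentiable (@expR R) x by exact/derivable1_diffP.
elim: k f => [|k IH] f Cf.
  by apply: Ck_on0 => x Ux; apply: differentiable_comp (dexp _); exact: Ck_on_diff Cf Ux.
have [C0f Df] := proj1 (Ck_onS k f) Cf.
apply/Ck_onS; split=> [|i].
  by apply: Ck_on0 => x Ux; apply: differentiable_comp (dexp _); exact: Ck_on_diff C0f Ux.
apply: eq_Ck_on (Ck_onM (Df i) (IH _ (Ck_onW Cf))) => x Ux.
have dfx : differentiable f x := Ck_on_diff C0f Ux.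
rewrite (deriveE _ dfx) [in RHS](deriveE _ (differentiable_comp dfx (dexp _))).
by rewrite (diff_comp dfx (dexp _)) /= diff1E// derive1E derive_val.
Qed.

End SmoothOn.

Section Smooth.
Variables (R : realType) (n : nat) (G : lieGroup R n).
Implicit Types f g : G -> R.

Lemma smooth_cst (a : R) : smooth (fun _ : G => a).
Proof. by move=> c _; apply/smooth_on_Ck => k; exact: (Ck_on_cst (@cran_open _ _ _ c) a). Qed.

Lemma smoothD f g : smooth f -> smooth g -> smooth (fun p => f p + g p).
Proof.
move=> Cf Cg c cc; apply/smooth_on_Ck => k.
by apply: (@Ck_onD _ _ _ (@cran_open _ _ _ c) k (f \o cinv c) (g \o cinv c));
  move: k; apply/smooth_on_Ck; [exact: Cf|exact: Cg].
Qed.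

Lemma smoothM f g : smooth f -> smooth g -> smooth (fun p => f p * g p).
Proof.
move=> Cf Cg c cc; apply/smooth_on_Ck => k.
by apply: (@Ck_onM _ _ _ (@cran_open _ _ _ c) k (f \o cinv c) (g \o cinv c));
  move: k; apply/smooth_on_Ck; [exact: Cf|exact: Cg].
Qed.

Lemma smooth_expR f : smooth f -> smooth (fun p => expR (f p)).
Proof.
move=> Cf c cc; apply/smooth_on_Ck => k.
by apply: (@Ck_on_expR _ _ _ (@cran_open _ _ _ c) k (f \o cinv c));
  move: k; apply/smooth_on_Ck; exact: Cf.
Qed.

Lemma smoothZ (a : R) f : smooth f -> smooth (fun p => a * f p).
Proof. by move=> Cf; apply: smoothM => //; exact: smooth_cst. Qed.

Lemma smoothN f : smooth f -> smooth (fun p => - f p).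
Proof.
by move=> /(smoothZ (-1)); under eq_fun do rewrite mulN1r.
Qed.

End Smooth.

(** * Vector fields as derivations *)

Section Derivation.
Variables (R : realType) (n : nat) (G : lieGroup R n).
Variable X : (G -> R) -> (G -> R).
Hypothesis vfX : vector_field X.
Implicit Types (f g : G -> R) (a b c : R) (p : G).

Lemma vf0 p : X (fun _ => 0) p = 0.
Proof.
case: vfX => _ lin _; have S0 := @smooth_cst _ _ G 0.
have := lin 1 _ _ S0 S0 p; under eq_fun do rewrite mulr0 addr0.
by rewrite mul1r => /eqP; rewrite -subr_eq subrr eq_sym => /eqP.
Qed.

Lemma vfZ a f p : smooth f -> X (fun q => a * f q) p = a * X f p.
Proof.
case: vfX => _ lin _ Sf; have := lin a f _ Sf (@smooth_cst _ _ G 0) p.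
by under eq_fun do rewrite addr0; rewrite vf0 addr0.
Qed.

Lemma vfD f g p : smooth f -> smooth g ->
  X (fun q => f q + g q) p = X f p + X g p.
Proof.
case: vfX => _ lin _ Sf Sg; have := lin 1 f g Sf Sg p.
by under eq_fun do rewrite mul1r; rewrite mul1r.
Qed.

Lemma vfM f g p : smooth f -> smooth g ->
  X (fun q => f q * g q) p = f p * X g p + g p * X f p.
Proof. by case: vfX => _ _ leib Sf Sg; exact: leib. Qed.

Lemma vf_cst a p : X (fun _ => a) p = 0.
Proof.
have S1 := @smooth_cst _ _ G 1.
have X1 : X (fun _ => 1) p = 0.
  have := vfM p S1 S1; under eq_fun do rewrite mulr1.
  by rewrite mul1r => /eqP; rewrite -subr_eq subrr eq_sym => /eqP.
by have := vfZ a p S1; under eq_fun do rewrite mulr1; rewrite X1 mulr0.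
Qed.

Lemma vf_affine a b1 b2 b3 f1 f2 f3 p : smooth f1 -> smooth f2 -> smooth f3 ->
  X (fun q => a + b1 * f1 q + b2 * f2 q - b3 * f3 q) p =
  b1 * X f1 p + b2 * X f2 p - b3 * X f3 p.
Proof.
move=> S1 S2 S3.
under eq_fun do rewrite -mulNr.
have Sb b f : smooth f -> smooth (fun q => b * f q) by exact: smoothZ.
have Sa := @smooth_cst _ _ G a.
rewrite vfD; [|by apply: smoothD; [apply: smoothD|]; auto|by auto].
rewrite vfD; [|by apply: smoothD; auto|by auto].
by rewrite vfD ?vf_cst ?vfZ ?mulNr ?add0r//; auto.
Qed.

End Derivation.

(** A Kronecker symbol in the form of a test that simpl evaluates on numerals. *)
Definition delta {R : realType} (i j : nat) : R := if eqn i j then 1 else 0.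

Lemma deltaE {R : realType} (i j : nat) : (i == j)%:R = delta i j :> R.
Proof. by rewrite /delta -eqnE; case: eqn. Qed.

(** * Levi-Civita connection of a metric conformal to an orthonormal one *)

Section ConformalConnection.
Variables (R : realType) (n : nat) (G : lieGroup R n) (g : lieAlgebra R).
Variables (phi : g -> (G -> R) -> (G -> R)) (e : n.-tuple g).
Variables (m : G -> g -> g -> R) (u : G -> R).
Hypothesis vf_phi : forall x, vector_field (phi x).
Hypothesis gramE : forall x, gram e m x = (u x)%:M.
Hypothesis u_smooth : smooth u.
Hypothesis u_neq0 : forall x, u x != 0.

Local Notation c := (str_const e).

(** The frame components of df when u = exp(2f). *)
Definition dlog (i : 'I_n) (x : G) : R := (2 * u x)^-1 * phi (tnth e i) u x.

(** The first term is Koszul's formula for a left-invariant metric with an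
   orthonormal frame; the three others are the usual
   nabla'_X Y - nabla_X Y = X(f) Y + Y(f) X - m(X, Y) grad f. *)
Lemma christoffel_conformal i j k x :
  christoffel phi e m i j k x =
    2^-1 * (c i j k - c i k j - c j k i)
    + delta j k * dlog i x + delta i k * dlog j x - delta i j * dlog k x.
Proof.
have gE y a b : gram e m y a b = delta a b * u y.
  by rewrite gramE mxE -deltaE mulr_natl.
have sumE (F : 'I_n -> R) (a : 'I_n) : \sum_s F s * delta s a = F a.
  rewrite (bigD1 a)//= -deltaE eqxx mulr1 big1 ?addr0// => s /negbTE sa.
  by rewrite -deltaE val_eqE sa mulr0.
have dE a b d : phi (tnth e a) (fun y => gram e m y b d) x
    = delta b d * phi (tnth e a) u x.
  by under eq_fun do rewrite gE; rewrite vfZ.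
have sum_c a b l : \sum_s c a b s * gram e m x s l = c a b l * u x.
  under eq_bigr do rewrite gE mulrA mulrAC.
  exact: (sumE (fun s => c a b s * u x)).
rewrite /christoffel [invmx _](_ : _ = (u x)^-1%:M); last by rewrite gramE invmx_scalar.
under eq_bigr do rewrite !dE !sumrB !sum_c mxE -mulr_natr -val_eqE deltaE mulrA.
rewrite sumE /dlog.
by field.
Qed.
End ConformalConnection.

(** * Curvature of the metric in the orthonormal frame *)

Notation o0 := (@Ordinal 4 0 isT).
Notation o1 := (@Ordinal 4 1 isT).
Notation o2 := (@Ordinal 4 2 isT).
Notation o3 := (@Ordinal 4 3 isT).

Lemma sum4 (R : nmodType) (F : 'I_4 -> R) :
  \sum_i F i = F o0 + F o1 + F o2 + F o3.
Proof.
rewrite !big_ord_recr big_ord0 /= add0r.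
by congr (F _ + F _ + F _ + F _); apply: val_inj.
Qed.

Lemma ord4P (P : 'I_4 -> Prop) : P o0 -> P o1 -> P o2 -> P o3 -> forall i, P i.
Proof.
move=> P0 P1 P2 P3 [[|[|[|[|//]]]] lt_i].
- by rewrite (_ : Ordinal _ = o0)//; apply: val_inj.
- by rewrite (_ : Ordinal _ = o1)//; apply: val_inj.
- by rewrite (_ : Ordinal _ = o2)//; apply: val_inj.
- by rewrite (_ : Ordinal _ = o3)//; apply: val_inj.
Qed.

Section Tables.
Variables (R : realType) (L p : R).

Definition struct4 (i j k : nat) : R :=
  match i, j, k with
  | 0, 2, 2 | 0, 3, 3 => L
  | 2, 0, 2 | 3, 0, 3 => (- L)%R
  | 1, 2, 3 => (p - 1)%R
  | 2, 1, 3 => (1 - p)%R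
  | 1, 3, 2 => (p + 1)%R
  | 3, 1, 2 => (- p - 1)%R
  | _, _, _ => 0%R
  end%N.

Definition gam4 (i j k : nat) : R :=
  match i, j, k with
  | 2, 2, 0 | 3, 3, 0 => L
  | 2, 0, 2 | 3, 0, 3 => (- L)%R
  | 2, 3, 1 | 3, 2, 1 => p
  | 2, 1, 3 | 3, 1, 2 => (- p)%R
  | 1, 3, 2 => 1%R
  | 1, 2, 3 => (- 1)%R
  | _, _, _ => 0%R
  end%N.

Definition ric4 (i j : nat) : R :=
  match i, j with
  | 0, 0 => (- 2 * L ^+ 2)%R
  | 1, 1 => (- 2 * p ^+ 2)%R
  | 2, 2 => (- 2 * L ^+ 2 + 2 * p)%R
  | 3, 3 => (- 2 * L ^+ 2 - 2 * p)%R
  | _, _ => 0%R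
  end%N.

Definition bach4 (i j : nat) : R :=
  let A := 3 + p ^+ 2 - L ^+ 2 in
  let C := 3 + 5 * p ^+ 2 - 3 * L ^+ 2 in
  match i, j with
  | 0, 0 => (2 / 3 * p ^+ 2 * A)%R
  | 1, 1 => (- 2 * p ^+ 2 * A)%R
  | 2, 2 => (2 / 3 * p ^+ 2 * A + 4 / 3 * p * C)%R
  | 3, 3 => (2 / 3 * p ^+ 2 * A - 4 / 3 * p * C)%R
  | _, _ => 0%R
  end%N.

Lemma gam4E (i j k : 'I_4) :
  2^-1 * (struct4 i j k - struct4 i k j - struct4 j k i) = gam4 i j k.
Proof.
by move: i j k; do 3 ![apply: ord4P]; rewrite /=; lra.
Qed.

End Tables.

Section Curvature.
Variables (R : realType) (G : lieGroup R 4) (g : lieAlgebra R).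
Variables (phi : g -> (G -> R) -> (G -> R)) (e : 4.-tuple g).
Variable m : G -> g -> g -> R.
Variables (L p : R).
Hypothesis vf_phi : forall x, vector_field (phi x).
Hypothesis cE : forall i j k, str_const e i j k = struct4 L p i j k.
Hypothesis orth : Defs.orthonormal e m.

Let gramE x : gram e m x = (1 : R)%:M.
Proof. by apply/matrixP => i j; rewrite !mxE orth mulrb. Qed.

Lemma christoffelE i j k : christoffel phi e m i j k = fun _ => gam4 L p i j k.
Proof.
apply/funext => x.
have dlog0 a : dlog phi e (fun _ => 1) a x = 0 by rewrite /dlog vf_cst ?mulr0.
rewrite (@christoffel_conformal _ _ _ _ _ _ _ (fun _ => 1))//.
- by rewrite !dlog0 !mulr0 !addr0 subr0 !cE gam4E.
- exact: smooth_cst.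
Qed.

Definition riem4 (i j k l : nat) (s : 'I_4) : R :=
  gam4 L p j k s * gam4 L p i s l - gam4 L p i k s * gam4 L p j s l
  - struct4 L p i j s * gam4 L p s k l.

Lemma riemannE i j k l x :
  riemann phi e m i j k l x = \sum_s riem4 i j k l s.
Proof.
rewrite /riemann !christoffelE !vf_cst// subr0 add0r.
by apply: eq_bigr => s _; rewrite !christoffelE cE.
Qed.

Lemma ricciE i j : ricci phi e m i j = fun _ => ric4 L p i j.
Proof.
apply/funext => x; rewrite /ricci; under eq_bigr do rewrite riemannE.
rewrite sum4 !sum4; move: i j; do 2 ![apply: ord4P]; rewrite /riem4 /=.
all: by ring.
Qed.

(** As rho is diagonal and the connection is metric, the two terms of
   (nabla_q rho)_ij involve the same Christoffel symbol up to sign. *)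
Definition cov4 (q i j : nat) : R := gam4 L p q i j * (ric4 L p i i - ric4 L p j j).

Lemma cov_ricciE q i j : cov_ricci phi e m q i j = fun _ => cov4 q i j.
Proof.
apply/funext => x; rewrite /cov_ricci ricciE vf_cst// sum4 !christoffelE !ricciE.
rewrite /cov4; move: q i j; do 3 ![apply: ord4P]; rewrite /=; ring.
Qed.

Definition cov2_4 (r q i j s : nat) : R :=
  gam4 L p r q s * cov4 s i j + gam4 L p r i s * cov4 q s j
  + gam4 L p r j s * cov4 q i s.

Lemma cov2_ricciE r q i j x :
  cov2_ricci phi e m r q i j x = - \sum_(s < 4) cov2_4 r q i j s.
Proof.
rewrite /cov2_ricci cov_ricciE vf_cst// sub0r.
by congr (- _); apply: eq_bigr => s _; rewrite !christoffelE !cov_ricciE.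
Qed.

Lemma scalar_curvE x : scalar_curv phi e m x = - 6 * L ^+ 2 - 2 * p ^+ 2.
Proof. by rewrite /scalar_curv sum4 !ricciE /=; ring. Qed.

Lemma bachE i j x : bach phi e m i j x = bach4 L p i j.
Proof.
rewrite /bach.
under eq_bigr do rewrite cov2_ricciE.
under [X in _ - _ * X]eq_bigr do rewrite cov2_ricciE.
under [X in _ - X + _]eq_bigr do rewrite !ricciE.
under [X in 12^-1 * (3 * X - _)]eq_bigr => r _.
  under eq_bigr do rewrite ricciE.
  over.
rewrite scalar_curvE ricciE -val_eqE deltaE.
rewrite !sum4 /cov2_4 /cov4.
move: i j; do 2 ![apply: ord4P]; rewrite /delta /=; by field.
Qed.

Lemma bach_flat_frame : L ^+ 2 = 6 -> p ^+ 2 = 3 -> bach_flat phi m e.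
Proof.
move=> L2 p2 i j x; rewrite bachE /bach4 L2 p2.
by move: i j; do 2 ![apply: ord4P]; rewrite /=; ring.
Qed.

Lemma weylE i j k l x : weyl phi e m i j k l x =
  \sum_s riem4 i j k l s
  - 2^-1 * (ric4 L p j k * delta i l + ric4 L p i l * delta j k
            - ric4 L p i k * delta j l - ric4 L p j l * delta i k)
  - (L ^+ 2 + p ^+ 2 / 3) * (delta j k * delta i l - delta i k * delta j l).
Proof.
rewrite /weyl riemannE !ricciE scalar_curvE -!val_eqE !deltaE; by field.
Qed.

Lemma sgr_sub_nat (a b : nat) :
  Num.sg (b%:R - a%:R : R) = (if (a < b)%N then 1 else if (b < a)%N then -1 else 0).
Proof.
case: ltngtP => [ab|ba|->]; last by rewrite subrr sgr0.
- by rewrite gtr0_sg// subr_gt0 ltr_nat.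
- by rewrite ltr0_sg// subr_lt0 ltr_nat.
Qed.

(** The value does not depend on the sign: the double sum over the Hodge dual
   indices is a multiple of W_2301, which is zero. *)
Lemma weyl_pm_frame (sgn : R) x : L ^+ 2 = 6 -> p ^+ 2 = 3 ->
  weyl_pm phi m sgn e o0 o1 o0 o1 x = - 1.
Proof.
move=> L2 p2; rewrite /weyl_pm /levi_civita !sum4 !sgr_sub_nat /= !weylE !sum4 /riem4 /delta /=.
by field: L2 p2.
Qed.

Lemma not_half_conformally_flat (x0 : G) : L ^+ 2 = 6 -> p ^+ 2 = 3 ->
  ~ half_conformally_flat phi m e.
Proof.
move=> L2 p2.
by case=> /(_ o0 o1 o0 o1 x0) /eqP; rewrite weyl_pm_frame// oppr_eq0 oner_eq0.
Qed.
End Curvature.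

(** * The metric is not conformally Einstein *)

Section NotConformallyEinstein.
Variables (R : realType) (G : lieGroup R 4) (g : lieAlgebra R).
Variables (phi : g -> (G -> R) -> (G -> R)) (e : 4.-tuple g).
Variable m : G -> g -> g -> R.
Variables (L p : R).
Hypothesis p_neq0 : p != 0.
Hypothesis vf_phi : forall x, vector_field (phi x).
Hypothesis cE : forall i j k, str_const e i j k = struct4 L p i j k.
Hypothesis orth : Defs.orthonormal e m.
Hypothesis comm23 : forall h x, smooth h ->
  phi (tnth e o2) (phi (tnth e o3) h) x = phi (tnth e o3) (phi (tnth e o2) h) x.

Section Conformal.
Variable f : G -> R.
Hypothesis f_smooth : smooth f.

Let u x := expR (2 * f x).
Let w := dlog phi e u.
Let mu := conformal_change f m.

Let u_smooth : smooth u.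
Proof. exact/smooth_expR/smoothZ. Qed.

(* The factor (2u)^-1 is smooth because it is half the exponential of -2f. *)
Let w_smooth i : smooth (w i).
Proof.
have -> : w i = fun x => (2^-1 * expR (- (2 * f x))) * phi (tnth e i) u x.
  by apply/funext => x; rewrite /w /dlog invfM -expRN.
apply: smoothM; first exact/smoothZ/smooth_expR/smoothN/smoothZ.
by have [+ _ _] := vf_phi (tnth e i); apply.
Qed.

Definition cgam (v : 'I_4 -> R) (i j k : 'I_4) : R :=
  gam4 L p i j k + delta j k * v i + delta i k * v j - delta i j * v k.

Let christoffel_mu i j k : christoffel phi e mu i j k = fun x => cgam (w^~ x) i j k.
Proof.
apply/funext => x; rewrite (@christoffel_conformal _ _ _ _ _ _ _ u)//.
- by rewrite /cgam !cE gam4E.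
- by move=> y; apply/matrixP => i' j'; rewrite !mxE /mu /conformal_change orth mulr_natr.
- by move=> y; rewrite gt_eqF ?expR_gt0.
Qed.

Let dw i j x : R := phi (tnth e i) (w j) x.

Let riemann_mu i j k l x : riemann phi e mu i j k l x =
  (delta k l * dw i j x + delta j l * dw i k x - delta j k * dw i l x)
  - (delta k l * dw j i x + delta i l * dw j k x - delta i k * dw j l x)
  + \sum_s (cgam (w^~ x) j k s * cgam (w^~ x) i s l
            - cgam (w^~ x) i k s * cgam (w^~ x) j s l
            - struct4 L p i j s * cgam (w^~ x) s k l).
Proof.
rewrite /riemann !christoffel_mu !vf_affine//.
by congr (_ + _); apply: eq_bigr => s _; rewrite !christoffel_mu cE.
Qed.

Hypothesis ein : einstein phi e mu.

Let ricci_off i j x : i != j -> ricci phi e mu i j x = 0.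
Proof.
case: ein => lam + ij => /(_ x i j) ->.
by rewrite mxE /mu /conformal_change orth (negbTE ij) !mulr0.
Qed.

Let ricci_diag x : ricci phi e mu o2 o2 x = ricci phi e mu o3 o3 x.
Proof.
case: ein => lam einE; rewrite !einE !mxE /mu /conformal_change !orth.
by rewrite !eqxx.
Qed.

(** For j <> k, the second derivatives in the Ricci component (j, k) of mu form
   the combination E_k w_j - 3 E_j w_k. The components (j, k) and (k, j) together
   therefore determine both E_j w_k and E_k w_j. *)
Let hess x :
  [/\ dw o2 o1 x = w o2 x * w o1 x - p * w o3 x,
      dw o3 o1 x = w o3 x * w o1 x - p * w o2 x,
      dw o3 o2 x = dw o2 o3 x
    & dw o3 o3 x - dw o2 o2 x = w o3 x ^+ 2 - w o2 x ^+ 2 - 2 * p].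
Proof.
have ricE i j : ricci phi e mu i j x = \sum_k riemann phi e mu k i j k x by [].
have := (@ricci_off o1 o2 x isT, @ricci_off o2 o1 x isT, @ricci_off o1 o3 x isT,
  @ricci_off o3 o1 x isT, @ricci_off o2 o3 x isT, @ricci_off o3 o2 x isT, ricci_diag x).
rewrite !ricE !sum4 !riemann_mu !sum4 /cgam /delta /=.
set w0 := w o0 x; set w1 := w o1 x; set w2 := w o2 x; set w3 := w o3 x.
case=> [[[[[[h12 h21] h13] h31] h23] h32] hd].
split; lra.
Qed.

Lemma conformally_einstein_absurd (x : G) : False.
Proof.
have d1 : phi (tnth e o3) (w o1) = fun y => w o3 y * w o1 y + (- p) * w o2 y.
  by apply/funext => y; have [_ + _ _] := hess y; rewrite /dw => ->; rewrite mulNr.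
have d2 : phi (tnth e o2) (w o1) = fun y => w o2 y * w o1 y + (- p) * w o3 y.
  by apply/funext => y; have [+ _ _ _] := hess y; rewrite /dw => ->; rewrite mulNr.
have dE i a b c : phi (tnth e i) (fun y => w a y * w b y + (- p) * w c y) x =
    w a x * phi (tnth e i) (w b) x + w b x * phi (tnth e i) (w a) x
    - p * phi (tnth e i) (w c) x.
  have Sab : smooth (fun y => w a y * w b y) by exact: smoothM.
  have Sc : smooth (fun y => (- p) * w c y) by exact: smoothZ.
  rewrite (vfD _ x Sab Sc)// (vfM _ x (w_smooth a) (w_smooth b))//.
  by rewrite (vfZ _ _ x (w_smooth c))// mulNr.
(* E_2 E_3 w_1 = E_3 E_2 w_1, both sides expanded by the formulas for E_i w_1 *)
have := comm23 x (w_smooth o1); rewrite d1 d2 !dE.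
have := hess x; rewrite /dw => -[h1 h2 h3 h4]; rewrite h1 h2 h3 => comm.
have : p * (- 2 * p) = 0.
  rewrite [- 2 * p](_ : _ = phi (tnth e o3) (w o3) x - phi (tnth e o2) (w o2) x
    - w o3 x ^+ 2 + w o2 x ^+ 2); last by rewrite h4; ring.
  by lra.
by move=> pp; move: p_neq0; rewrite -sqrf_eq0 => /eqP; apply; lra.
Qed.

End Conformal.

Lemma not_conformally_einstein (x0 : G) : ~ conformally_einstein phi m e.
Proof. by case=> f Sf /(conformally_einstein_absurd Sf); apply. Qed.

End NotConformallyEinstein.

(** * The solvable Lie algebra *)

Section BracketSpace.
Variables (K : fieldType) (g : lieAlgebra K).
Implicit Types (U V W : {vspace g}) (x y : g).

Let brkl y : {linear g -> g} := HB.pack (fun x => brk x y)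
  (GRing.isLinear.Build _ _ _ _ _ (@brk_linearl _ g y)).

Let brkr x : {linear g -> g} := HB.pack (brk x)
  (GRing.isLinear.Build _ _ _ _ _ (@brk_linearr _ g x)).

Lemma brk_suml n (a : 'I_n -> K) (F : 'I_n -> g) y :
  brk (\sum_i a i *: F i) y = \sum_i a i *: brk (F i) y.
Proof.
rewrite [LHS](linear_sum (brkl y)).
by apply: eq_bigr => i _; exact: (linearZZ (brkl y)).
Qed.

Lemma brk_sumr n (a : 'I_n -> K) (F : 'I_n -> g) x :
  brk x (\sum_i a i *: F i) = \sum_i a i *: brk x (F i).
Proof.
rewrite [LHS](linear_sum (brkr x)).
by apply: eq_bigr => i _; exact: (linearZZ (brkr x)).
Qed.

Lemma mem_brkv U V x y : x \in U -> y \in V -> brk x y \in brkv U V.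
Proof.
move=> /coord_vbasis -> /coord_vbasis ->.
rewrite brk_suml; apply: memv_suml => i _; apply: memvZ.
rewrite brk_sumr; apply: memv_suml => j _; apply: memvZ.
by apply/memv_span/allpairs_f; apply: mem_nth; rewrite size_tuple.
Qed.

Lemma sub_brkv U V W : (forall x y, x \in U -> y \in V -> brk x y \in W) ->
  (brkv U V <= W)%VS.
Proof.
move=> UVW; apply/span_subvP => _ /allpairsP[[x y] /= [Ux Vy ->]].
by apply: UVW; exact: vbasis_mem.
Qed.
End BracketSpace.

Section Algebra.
Variables (R : realType) (L p : R).

Definition brk4 (x y : 'rV[R]_4) : 'rV[R]_4 := \row_k
  match nat_of_ord k with
  | 2%N => L * (x 0 o0 * y 0 o2 - x 0 o2 * y 0 o0)
           + (p + 1) * (x 0 o1 * y 0 o3 - x 0 o3 * y 0 o1)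
  | 3%N => L * (x 0 o0 * y 0 o3 - x 0 o3 * y 0 o0)
           + (p - 1) * (x 0 o1 * y 0 o2 - x 0 o2 * y 0 o1)
  | _ => 0
  end.

Lemma row4P (x y : 'rV[R]_4) : x 0 o0 = y 0 o0 -> x 0 o1 = y 0 o1 ->
  x 0 o2 = y 0 o2 -> x 0 o3 = y 0 o3 -> x = y.
Proof. by move=> *; apply/rowP; apply: ord4P. Qed.

Lemma brk4_linearl y : linear (fun x => brk4 x y).
Proof. by move=> a x x'; apply: row4P; rewrite !mxE /=; ring. Qed.

Lemma brk4_linearr x : linear (brk4 x).
Proof. by move=> a y y'; apply: row4P; rewrite !mxE /=; ring. Qed.

Lemma brk4_alt x : brk4 x x = 0.
Proof. by apply: row4P; rewrite !mxE /=; ring. Qed.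

Lemma brk4_jacobi x y z :
  brk4 x (brk4 y z) + brk4 y (brk4 z x) + brk4 z (brk4 x y) = 0.
Proof. by apply: row4P; rewrite !mxE /=; ring. Qed.

Definition lie4 : lieAlgebra R := @LieAlgebra R 'rV[R]_4 brk4
  brk4_linearl brk4_linearr brk4_alt brk4_jacobi.

Definition frame4 : 4.-tuple lie4 := [tuple (delta_mx 0 i : 'rV[R]_4) | i < 4].

Lemma dim_lie4 : \dim {:lie4} = 4%N.
Proof. by rewrite dimvf /dim /=. Qed.

Lemma frame4_basis : basis_of fullv frame4.
Proof.
rewrite basisEdim size_tuple dim_lie4 leqnn andbT.
apply/subvP => v _; rewrite [v]row_sum_delta.
apply: memv_suml => i _; apply/memvZ/memv_span.
by rewrite -(tnth_mktuple (fun i => delta_mx 0 i : 'rV[R]_4) i) mem_tnth.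
Qed.

Lemma coord_frame4 (v : lie4) k : coord frame4 k v = (v : 'rV[R]_4) 0 k.
Proof.
have fr := basis_free frame4_basis.
rewrite [v in LHS]row_sum_delta -[RHS](coord_sum_free (fun i => (v : 'rV[R]_4) 0 i) k fr).
by congr (coord _ _ _); apply: eq_bigr => i _; rewrite -tnth_nth tnth_mktuple.
Qed.

Lemma str_const_frame4 i j k : str_const frame4 i j k = struct4 L p i j k.
Proof.
rewrite /str_const coord_frame4 !tnth_mktuple.
move: i j k; do 3 ![apply: ord4P]; rewrite !mxE /=; ring.
Qed.
End Algebra.

(** The length of the tuple in defined_over is \dim {:g}, which is not convertible
   to the length of a concrete frame. *)
Lemma defined_over_basis (K : fieldType) (g : lieAlgebra K) (F : K -> Prop)
    n (e : n.-tuple g) :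
  basis_of fullv e -> (forall i j k, F (str_const e i j k)) -> defined_over g F.
Proof.
move=> be Fe; have En : n = \dim {:g} by rewrite -(size_basis be).
by subst n; exists e.
Qed.

Lemma gen_subfield_struct4 (R : realType) (s2 s3 : R) i j k :
  gen_subfield [:: s2; s3] (struct4 (s2 * s3) s3 i j k).
Proof.
move=> F /GRing.divring_closedBM[F1 FB FM] sF.
have F0 : 0 \in F by rewrite -(subrr 1) FB.
have FN x : x \in F -> - x \in F by move=> Fx; rewrite -sub0r FB.
have FD x y : x \in F -> y \in F -> x + y \in F.
  by move=> Fx /FN Fy; rewrite -(opprK y) FB.
have [F2 F3] : s2 \in F /\ s3 \in F by split; apply: sF; rewrite !inE eqxx ?orbT.
have F23 := FM _ _ F2 F3.
by move: i j k => [|[|[|[|i]]]] [|[|[|[|j]]]] [|[|[|[|k]]]];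
  rewrite /struct4; auto.
Qed.

Section DerivedSeries.
Variables (R : realType) (L p : R).
Hypothesis L_neq0 : L != 0.

Local Notation g := (lie4 L p).
Local Notation e2 := (delta_mx 0 o2 : 'rV[R]_4).
Local Notation e3 := (delta_mx 0 o3 : 'rV[R]_4).
Local Notation D := <<[:: e2 : g; e3 : g]>>%VS.

Lemma mem_derived4 (x : g) : reflect
  ((x : 'rV[R]_4) 0 o0 = 0 /\ (x : 'rV[R]_4) 0 o1 = 0) (x \in D).
Proof.
apply: (iffP idP) => [|[x0 x1]].
  rewrite span_cons span_seq1 => /memv_addP[_ /vlineP[a ->] [_ /vlineP[b ->] ->]].
  by rewrite !mxE /= !mulr0 addr0.
rewrite (_ : x = (x : 'rV[R]_4) 0 o2 *: (e2 : g) + (x : 'rV[R]_4) 0 o3 *: (e3 : g)).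
  by rewrite memvD// memvZ// memv_span// !inE eqxx ?orbT.
by apply: row4P; rewrite !mxE /= ?x0 ?x1; ring.
Qed.

Lemma derived4_1 : derived g 1 = D.
Proof.
apply/eqP; rewrite eqEsubv; apply/andP; split.
  apply: sub_brkv => x y _ _; apply/mem_derived4; by rewrite !mxE.
apply/span_subvP => v; rewrite !inE => /orP[] /eqP ->.
- rewrite (_ : (e2 : g) = L^-1 *: brk (delta_mx 0 o0 : g) (e2 : g)).
    by apply/memvZ/mem_brkv; rewrite memvf.
  by apply: row4P; rewrite !mxE /=; field.
- rewrite (_ : (e3 : g) = L^-1 *: brk (delta_mx 0 o0 : g) (e3 : g)).
    by apply/memvZ/mem_brkv; rewrite memvf.
  by apply: row4P; rewrite !mxE /=; field.
Qed.

Lemma derived4_2 : derived g 2 = 0%VS.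
Proof.
apply/eqP; rewrite -subv0 -[derived g 2]/(brkv (derived g 1) (derived g 1)) derived4_1.
apply: sub_brkv => x y /mem_derived4[x0 x1] /mem_derived4[y0 y1].
rewrite memv0; apply/eqP; apply: row4P; rewrite !mxE /= ?x0 ?x1 ?y0 ?y1; ring.
Qed.

Lemma dim_derived4_1 : \dim (derived g 1) = 2%N.
Proof.
rewrite derived4_1; apply/eqP; rewrite -[_ == _]/(free [:: e2 : g; e3 : g]).
apply/(@freeP _ _ _ [tuple (e2 : g); (e3 : g)]) => k.
rewrite !big_ord_recl big_ord0 /= addr0 => /rowP k0 i.
have := k0 o2; have := k0 o3; rewrite !mxE /= !mulr1 !mulr0 addr0 add0r => k3 k2.
by case: i => [[|[|//]] i2]; [rewrite -[RHS]k2|rewrite -[RHS]k3]; congr (k _); apply: val_inj.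
Qed.

End DerivedSeries.

(** * The left-invariant metric and the conclusion *)

Section Metric4.
Variables (R : realType) (L p : R) (G : lieGroup R 4).
Local Notation g := (lie4 L p).

Definition metric4 (_ : G) (x y : g) : R :=
  \sum_i (x : 'rV[R]_4) 0 i * (y : 'rV[R]_4) 0 i.

Lemma metric4_riemannian : riemannian_metric metric4.
Proof.
split=> [q a x y z|q x y|q x x_neq0|x y]; last exact: smooth_cst.
- by rewrite /metric4 mulr_sumr -big_split; apply: eq_bigr => i _; rewrite !mxE mulrDl mulrA.
- by apply: eq_bigr => i _; rewrite mulrC.
- rewrite /metric4 lt_def sumr_ge0 ?andbT; last by move=> i _; rewrite -expr2 sqr_ge0.
  apply: contra_neq x_neq0 => /eqP; rewrite psumr_eq0 => [/allP x0|i _]; last first.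
    by rewrite -expr2 sqr_ge0.
  apply/rowP => i; rewrite mxE; apply/eqP.
  by have := x0 i (mem_index_enum _); rewrite /= mulf_eq0 orbb.
Qed.

Lemma metric4_orthonormal : Defs.orthonormal (frame4 L p) metric4.
Proof.
move=> x i j; rewrite !tnth_mktuple /metric4 sum4.
by move: i j; do 2 ![apply: ord4P]; rewrite !mxE /=; ring.
Qed.

End Metric4.

Theorem theorem4p1 (R : realType) :
  exists g : lieAlgebra R,
    [/\ \dim {:g} = 4%N,
        lie_solvable g,
        defined_over g (gen_subfield [:: Num.sqrt 2; Num.sqrt 3]),
        \dim (derived g 1) = 2%N
      & derived g 2 = 0%VS] /\
    forall (G : lieGroup R 4) (phi : g -> (G -> R) -> (G -> R)),
      lie_algebra_of phi ->
      exists m : G -> g -> g -> R,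
        [/\ riemannian_metric m, left_invariant_metric m
          & nontrivially_bach_flat phi m].
Proof.
set p : R := Num.sqrt 3; set L : R := Num.sqrt 2 * p.
have p2 : p ^+ 2 = 3 by rewrite sqr_sqrtr.
have L2 : L ^+ 2 = 6 by rewrite exprMn p2 sqr_sqrtr//; ring.
have p_neq0 : p != 0 by rewrite -sqrf_eq0 p2.
have L0 : L != 0 by rewrite -sqrf_eq0 L2.
exists (lie4 L p); split.
  split; [exact: dim_lie4|by exists 2%N; exact: derived4_2| |exact: dim_derived4_1|exact: derived4_2].
  apply: defined_over_basis (frame4_basis L p) _ => i j k.
  by rewrite str_const_frame4; exact: gen_subfield_struct4.
move=> G phi [phi_inv _ phi_brk _ _].
have vf_phi x := (phi_inv x).1.
have cE := str_const_frame4 L p.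
have orth := @metric4_orthonormal R L p G.
exists (@metric4 R L p G); split; [exact: metric4_riemannian|by []|].
exists (frame4 L p); split.
- exact: frame4_basis.
- exact: orth.
- exact: (bach_flat_frame vf_phi cE orth L2 p2).
- apply: not_conformally_einstein p_neq0 vf_phi cE orth _ (1%g : G) => h x Sh.
  (* [e2, e3] = 0 = [e2, e2], and the commutator of E_2 with itself is zero *)
  apply/eqP; rewrite -subr_eq0; apply/eqP.
  rewrite -phi_brk// (_ : brk _ _ = brk (tnth (frame4 L p) o2) (tnth (frame4 L p) o2)).
    by rewrite phi_brk// subrr.
  by rewrite !tnth_mktuple; apply: row4P; rewrite !mxE /=; ring.
- exact: (not_half_conformally_flat vf_phi cE orth (1%g : G) L2 p2).
Qed.
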